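(* Let $m,n\ge 1$ be integers, let $r\ge 1$ be a divisor of $n$, and let $\zeta_r$ be a primitive $r$-th root of unity. Then $$\widetilde{Z}_{m,n}(u,t,\zeta_r)=\left(\frac{1-t^r+u^{mr}t^r-u^{(m+1)r}}{1-u^r}\right)^{n/r}.$$ In particular, $$\widetilde{Z}_{m,n}(u,t,\zeta_r)=\widetilde{Z}_{m,1}(u^r,t^r,1)^{n/r}.$$
   Context: Pochhammer symbols: $(A;z)_N:=\prod_{j=0}^{N-1}(1-Az^j)$, with $1/(z;z)_k:=0$ for $k<0$. The master polynomial is the element of $\mathbb{Z}[u,t,z^{-1}]$ ($u,t,z$ indeterminates) given by $$\widetilde{Z}_{m,n}(u,t,z):=\sum_{n_1,\ldots,n_m\ge 0}\frac{u^{mn-\sum_{i=1}^m n_i}\,z^{-mn^2+\sum_{i=1}^m n_i^2}\,(z;z)_n\,(u^{-1}tz;z)_n}{(z;z)_{n-n_m}(z;z)_{n_m-n_{m-1}}\cdots(z;z)_{n_2-n_1}(z;z)_{n_1}(u^{-1}tz;z)_{n_1}}.$$ Evaluation at $z=\zeta_r$ (or $z=1$) means evaluating this Laurent polynomial. *)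

(* Defs.v *)
From HB Require Import structures.
From mathcomp Require Import all_boot all_order all_algebra.
From mathcomp Require Import ring zify mpoly.

Set Implicit Arguments.
Unset Strict Implicit.
Unset Printing Implicit Defensive.

Import Order.TTheory GRing.Theory Num.Theory.
Local Open Scope ring_scope.

Section MasterSum.
Variable F : fieldType.

Definition poch (A z : F) (N : nat) : F := \prod_(j < N) (1 - A * z ^+ j).

(* 1 / (z; z)_k, with the convention that it is 0 for k < 0 *)
Definition inv_poch (z : F) (k : int) : F :=
  if k is Posz j then (poch z z j)^-1 else 0.

(* n_i for 0 <= i <= m + 1, where s = (n_1, ..., n_m), n_0 = 0, n_(m+1) = n *)
Definition idx (m n : nat) (s : m.-tuple 'I_n.+1) (i : nat) : nat :=
  nth 0%N (0%N :: rcons [seq val k | k <- s] n) i.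

(* The sum only ranges over indices n_i <= n: if some n_i > n, then one of the
   differences n_(j+1) - n_j with i <= j <= m is negative and the summand is 0. *)
Definition master_sum (u t z : F) (m n : nat) : F :=
  \sum_(s : m.-tuple 'I_n.+1)
    u ^ ((m * n)%:Z - \sum_(1 <= i < m.+1) (idx s i)%:Z) *
    z ^ (- (m * n ^ 2)%:Z + \sum_(1 <= i < m.+1) ((idx s i) ^ 2)%:Z) *
    poch z z n * poch (u^-1 * t * z) z n *
    (\prod_(0 <= i < m.+1) inv_poch z ((idx s i.+1)%:Z - (idx s i)%:Z)) /
    poch (u^-1 * t * z) z (idx s 1).

End MasterSum.

Section Integrality.
Variables (F : fieldType) (u t z : F) (S : F -> Prop).
Hypothesis u0 : u != 0.
Hypothesis z0 : z != 0.
Hypothesis z_neq1 : forall j, 1 - z ^+ j.+1 != 0.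
Hypothesis u_neq : forall j, 1 - u^-1 * t * z * z ^+ j != 0.
Hypothesis S0 : S 0.
Hypothesis S1 : S 1.
Hypothesis SN : forall x, S x -> S (- x).
Hypothesis SD : forall x y, S x -> S y -> S (x + y).
Hypothesis SM : forall x y, S x -> S y -> S (x * y).
Hypothesis Su : S u.
Hypothesis St : S t.
Hypothesis Sw : S z^-1.

Let w := z^-1.
Let P := poch z z.
Let Q := poch (u^-1 * t * z) z.

Let w0 : w != 0. Proof. by rewrite invr_eq0. Qed.

Let SX x k : S x -> S (x ^+ k).
Proof. by move=> Sx; elim: k => [|k IH]; rewrite ?expr0 // exprS; apply: SM. Qed.

Let PS k : P k.+1 = P k * (1 - z ^+ k.+1).
Proof. by rewrite /P /poch big_ord_recr /= -exprS. Qed.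

Let P0 k : P k != 0.
Proof.
elim: k => [|k IH]; first by rewrite /P /poch big_ord0 oner_eq0.
by rewrite PS mulf_neq0.
Qed.

Let QS k : Q k.+1 = Q k * (1 - u^-1 * t * z * z ^+ k).
Proof. by rewrite /Q /poch big_ord_recr. Qed.

Let Q0 k : Q k != 0.
Proof.
elim: k => [|k IH]; first by rewrite /Q /poch big_ord0 oner_eq0.
by rewrite QS mulf_neq0.
Qed.

Let wz k l : w ^+ (k + l) * z ^+ l = w ^+ k.
Proof. by rewrite exprD -mulrA -exprMn mulVf // expr1n mulr1. Qed.

Let S_qbin a d : S (w ^+ (a * d) * (P (a + d) / (P a * P d))).
Proof.
have Pz : P 0 = 1 by rewrite /P /poch big_ord0.
have [k] := ubnP (a + d); elim: k a d => // k IH [|a] [|d] lek.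
- by rewrite Pz expr0 !mul1r invr1.
- by rewrite mul0n expr0 Pz !mul1r divff.
- by rewrite muln0 expr0 addn0 Pz mulr1 mul1r divff.
have -> : w ^+ (a.+1 * d.+1) * (P (a.+1 + d.+1) / (P a.+1 * P d.+1)) =
    w ^+ (a * d.+1) * (P (a + d.+1) / (P a * P d.+1)) +
    w ^+ a.+1 * (w ^+ (a.+1 * d) * (P (a.+1 + d) / (P a.+1 * P d))).
  have E1 : P (a.+1 + d.+1) = P (a + d.+1) * (1 - z ^+ (a + d.+1).+1).
    by rewrite addSn PS.
  have E2 : P (a.+1 + d) = P (a + d.+1) by rewrite addSnnS.
  have Ea : w ^+ a.+1 * w ^+ (a.+1 * d) = w ^+ (a.+1 * d.+1).
    by rewrite -exprD mulnS.
  have Eb : w ^+ (a * d.+1) = w ^+ (a.+1 * d.+1) * z ^+ d.+1.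
    by rewrite mulSn addnC wz.
  rewrite E1 E2 [in RHS]mulrA Ea Eb -!mulrA -mulrDr; congr (_ * _).
  rewrite [z ^+ _ * _]mulrCA -mulrDr; congr (_ * _).
  rewrite !PS !invfM.
  have Hd : (P d)^-1 = (P d)^-1 * (1 - z ^+ d.+1)^-1 * (1 - z ^+ d.+1).
    by rewrite -mulrA mulVf // mulr1.
  have Ha : (P a)^-1 = (P a)^-1 * (1 - z ^+ a.+1)^-1 * (1 - z ^+ a.+1).
    by rewrite -mulrA mulVf // mulr1.
  rewrite [in X in _ = _ + X]Hd [in X in _ = X + _]Ha.
  set A := (P a)^-1 * _; set D := (P d)^-1 * _.
  have -> : 1 - z ^+ (a + d.+1).+1 = z ^+ d.+1 * (1 - z ^+ a.+1) + (1 - z ^+ d.+1).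
    have -> : z ^+ (a + d.+1).+1 = z ^+ d.+1 * z ^+ a.+1.
      by rewrite -exprD; congr (_ ^+ _); lia.
    by ring.
  by ring.
apply: SD; first by apply: IH; move: lek; rewrite addSn ltnS.
apply: SM; first exact: SX.
by apply: IH; move: lek; rewrite addnS ltnS.
Qed.

Let S_chain (a : nat -> nat) k : a 0%N = 0%N -> (forall i, i <= k -> a i <= a i.+1)%N ->
  S (w ^+ (\sum_(1 <= i < k.+1) a i * (a i.+1 - a i)) *
     (P (a k.+1) * \prod_(0 <= i < k.+1) (P (a i.+1 - a i))^-1)).
Proof.
move=> a0; elim: k => [|k IH] mon.
  by rewrite big_geq // big_nat1 expr0 a0 subn0 divff // mulr1.
rewrite (@big_nat_recr _ _ _ k.+1 1) // (@big_nat_recr _ _ _ k.+1 0) //= exprD.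
have := S_qbin (a k.+1) (a k.+2 - a k.+1); rewrite subnKC ?mon // => Sq.
have {}IH := IH (fun i hi => mon i (leqW hi)).
have := SM IH Sq.
set X := w ^+ _; set Y := w ^+ _; set p1 := P (a k.+1); set p2 := P (a k.+2).
set R := \prod_(_ <= _ < _) _; set d := P _.
suff -> : X * (p1 * R) * (Y * (p2 / (p1 * d))) = X * Y * (p2 * (R / d)) by [].
have e : p1 / p1 = 1 by apply: divff; apply: P0.
have -> : X * (p1 * R) * (Y * (p2 / (p1 * d))) = X * Y * (p2 * (R / d)) * (p1 / p1).
  by rewrite invfM; clearbody X Y p1 p2 R d; ring.
by rewrite e mulr1.
Qed.

Let S_tail a d : S (u ^+ d * w ^+ (\sum_(j < d) (a + j).+1) * (Q (a + d) / Q a)).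
Proof.
elim: d => [|d IH]; first by rewrite big_ord0 !expr0 addn0 !mul1r divff.
rewrite big_ord_recr /= exprS exprD addnS QS.
set X := w ^+ _ in IH *; set e := 1 - _.
have -> : u * u ^+ d * (X * w ^+ (a + d).+1) * (Q (a + d) * e / Q a) =
   (u ^+ d * X * (Q (a + d) / Q a)) * (u * w ^+ (a + d).+1 * e).
  by ring.
apply: SM => //.
have -> : u * w ^+ (a + d).+1 * e = u * w ^+ (a + d).+1 - t.
  rewrite mulrBr mulr1; congr (_ - _).
  rewrite -!mulrA -exprS [w ^+ _ * _]mulrCA mulVKf //.
  by rewrite mulrCA -exprMn mulVf // expr1n mulr1.
by apply: SD; [apply: SM => //; exact: SX | exact: SN].
Qed.

Let exp_bound (a : nat -> nat) m n : a 0%N = 0%N -> a m.+1 = n ->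
  (forall i, i <= m -> a i <= a i.+1)%N -> (forall i, i <= m.+1 -> a i <= n)%N ->
  (\sum_(1 <= i < m.+1) a i * a i.+1 + \sum_(j < n - a 1%N) (a 1%N + j).+1
     <= m * n ^ 2)%N.
Proof.
move=> a0 am mon bnd; case: m am mon bnd => [|m] am mon bnd.
  by rewrite big_geq // am subnn big_ord0.
rewrite big_ltn // mulSn addnAC leq_add //.
  have a1n : (a 1 <= n)%N by apply: bnd.
  have h : (\sum_(j < n - a 1) (a 1 + j).+1 <= (n - a 1) * n)%N.
    rewrite -[X in (X * _)%N]card_ord -sum_nat_const leq_sum // => j _.
    by have := ltn_ord j; rewrite ltn_subRL.
  have h2 : (a 1 * a 2 <= a 1 * n)%N by rewrite leq_mul2l bnd ?orbT.
  by rewrite (leq_trans (leq_add h2 h)) // -mulnDl subnKC // mulnn.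
have -> : (m * n ^ 2 = \sum_(2 <= i < m.+2) n ^ 2)%N.
  by rewrite sum_nat_const_nat !subSS subn0.
rewrite [leqLHS]big_nat_cond [leqRHS]big_nat_cond leq_sum // => i; rewrite andbT => /andP[_ hi].
by rewrite -mulnn leq_mul // bnd // ltnW.
Qed.

Lemma master_sum_closed m n : S (master_sum u t z m n).
Proof.
rewrite /master_sum; elim/big_ind: _ => // s _.
have a0 : idx s 0 = 0%N by [].
have am : idx s m.+1 = n.
  by rewrite /idx /= nth_rcons size_map size_tuple ltnn eqxx.
have bnd i : (i <= m.+1)%N -> (idx s i <= n)%N.
  case: i => // i; rewrite ltnS => hi; rewrite /idx /= nth_rcons size_map size_tuple.
  case: ltngtP hi => // him _.
  by rewrite (nth_map ord0) ?size_tuple // -ltnS.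
move: (idx s) a0 am bnd => a a0 am bnd.
have [/allP mon|/allPn[i]] := boolP (all (fun i => a i <= a i.+1)%N (iota 0 m.+1));
    last first.
  rewrite mem_iota /= add0n -ltnNge => hi lti.
  suff -> : \prod_(0 <= i < m.+1) inv_poch z ((a i.+1)%:Z - (a i)%:Z) = 0.
    by rewrite mulr0 mul0r.
  apply/eqP; rewrite prodf_seq_eq0; apply/hasP; exists i.
    by rewrite mem_index_iota.
  have : (a i.+1)%:Z - (a i)%:Z < 0 by rewrite subr_lt0 ltz_nat.
  by rewrite /=; case: (_ - _) => //= k _; rewrite eqxx.
have {}mon i : (i <= m)%N -> (a i <= a i.+1)%N.
  by move=> hi; apply: mon; rewrite mem_iota.
have -> : \prod_(0 <= i < m.+1) inv_poch z ((a i.+1)%:Z - (a i)%:Z) =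
          \prod_(0 <= i < m.+1) (P (a i.+1 - a i))^-1.
  by apply: eq_big_nat => i /andP[_ hi]; rewrite subzn // mon.
have hexp := exp_bound a0 am mon bnd.
have Sc := S_chain a0 mon; rewrite am in Sc.
have a1n : (a 1%N <= n)%N by apply: bnd.
have St' := S_tail (a 1%N) (n - a 1%N); rewrite subnKC // in St'.
move: St' Sc; set b := (\sum_(j < _) _)%N in hexp *.
set c := (\sum_(_ <= _ < _) _)%N => St' Sc.
have hu : (\sum_(1 <= i < m.+1) a i + (n - a 1) <= m * n)%N.
  case: (m) am bnd => [|k] am' bnd'; first by rewrite big_geq // am' subnn.
  rewrite big_ltn // addnAC subnKC // mulSn leq_add2l.
  have -> : (k * n = \sum_(2 <= i < k.+2) n)%N.
    by rewrite sum_nat_const_nat !subSS subn0.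
  rewrite [leqLHS]big_nat_cond [leqRHS]big_nat_cond leq_sum // => i; rewrite andbT => /andP[_ hi].
  by rewrite bnd' // ltnW.
have hc : (c + \sum_(1 <= i < m.+1) a i ^ 2 = \sum_(1 <= i < m.+1) a i * a i.+1)%N.
  rewrite -big_split /=; apply: eq_big_nat => i /andP[_ hi].
  by rewrite -mulnn -mulnDr subnK // mon // -ltnS ltnW.
have sumZ (f : nat -> nat) : \sum_(1 <= i < m.+1) (f i)%:Z =
    (\sum_(1 <= i < m.+1) f i)%N%:Z.
  by elim/big_ind2: _ => // x1 x2 y1 y2 -> ->.
rewrite (sumZ a) (sumZ (fun i => a i ^ 2)%N).
move: hu hc hexp; set A := (\sum_(_ <= _ < _) _)%N; set B := (\sum_(_ <= _ < _) _)%N.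
set C := (\sum_(_ <= _ < _) _)%N => hu hc hexp.
pose e1 := (m * n - (A + (n - a 1)))%N; pose e2 := (m * n ^ 2 - (C + b))%N.
have -> : (m * n)%:Z - A%:Z = (e1 + (n - a 1%N))%N%:Z.
  by rewrite -(subnKC hu) -/e1; lia.
have -> : - (m * n ^ 2)%:Z + B%:Z = - (e2 + c + b)%N%:Z.
  by rewrite -(subnKC hexp) -/e2; lia.
rewrite -exprnN -exprVn -/w -exprnP !exprD.
have := SM (SM (SX e1 Su) (SX e2 Sw)) (SM St' Sc); rewrite -/w.
set R := \prod_(_ <= _ < _) _; rewrite -/(P n) -/(Q n) -/(Q (a 1%N)).
suff -> : forall x1 x2 y1 y2 y3 p q q1 r : F,
    x1 * y1 * (x2 * y3 * (q / q1) * (y2 * (p * r))) =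
    x1 * x2 * (y1 * y2 * y3) * p * q * r / q1 by [].
by move=> *; ring.
Qed.
End Integrality.

Local Notation "x %:F" := (@tofrac _ x).

(* {mpoly int[3]} is Z[u, t, z^-1]: its variables are u, t and z^-1, in this
   order. Its fraction field is Q(u, t, z). *)
Definition master_frac (m n : nat) : {fraction {mpoly int[3]}} :=
  master_sum ('X_0)%:F ('X_1)%:F ('X_2)%:F^-1 m n.

Lemma master_frac_integral m n :
  exists p : {mpoly int[3]}, p%:F == master_frac m n.
Proof.
pose X i : {fraction {mpoly int[3]}} := ('X_i)%:F.
have X0 i : X i != 0.
  rewrite tofrac_eq0; apply/eqP => /(congr1 (meval (fun=> 1%R : int))).
  by rewrite mevalXU meval0.
suff [p e] : exists p : {mpoly int[3]}, p%:F = master_frac m n by exists p; apply/eqP.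
apply: (@master_sum_closed _ (X 0) (X 1) (X 2)^-1
          (fun x => exists p : {mpoly int[3]}, p%:F = x)).
- exact: X0.
- by rewrite invr_eq0.
- move=> j; apply/eqP => /(congr1 (fun x => X 2 ^+ j.+1 * x)).
  rewrite mulrBr mulr1 mulr0 -exprMn divff // expr1n => /eqP.
  rewrite -tofracXn -tofrac1 -tofracB tofrac_eq0.
  move=> /eqP/(congr1 (meval (fun=> 0 : int))).
  by rewrite mevalB meval1 rmorphXn /= mevalXU meval0 expr0n.
- move=> j; apply/eqP => eq0.
  have : X 0 * X 2 ^+ j.+1 - X 1 =
      X 0 * X 2 ^+ j.+1 * (1 - (X 0)^-1 * X 1 * (X 2)^-1 * (X 2)^-1 ^+ j).
    have gen (K : fieldType) (a b c : K) : a != 0 -> c != 0 ->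
        a * c ^+ j.+1 - b = a * c ^+ j.+1 * (1 - a^-1 * b * c^-1 * c^-1 ^+ j).
      by move=> a0 c0; rewrite exprVn exprS; field; rewrite a0 c0 expf_neq0.
    exact: gen.
  rewrite eq0 mulr0 => /eqP.
  rewrite -tofracXn -tofracM -tofracB tofrac_eq0.
  move=> /eqP/(congr1 (meval (fun i => (i == 1)%:R : int))).
  by rewrite mevalB mevalM !mevalXU meval0 mul0r.
- by exists 0; exact: tofrac0.
- by exists 1; exact: tofrac1.
- by move=> x [p <-]; exists (- p); exact: tofracN.
- by move=> x y [p <-] [q <-]; exists (p + q); exact: tofracD.
- by move=> x y [p <-] [q <-]; exists (p * q); exact: tofracM.
- by exists 'X_0.
- by exists 'X_1.
- by exists 'X_2; rewrite invrK.
Qed.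

Definition master_poly (m n : nat) : {mpoly int[3]} :=
  xchoose (master_frac_integral m n).

Lemma master_polyE m n : (master_poly m n)%:F = master_frac m n.
Proof. exact/eqP/(xchooseP (master_frac_integral m n)). Qed.

Definition master_eval (K : fieldType) (m n : nat) (u t z : K) : K :=
  mmap intr (tnth [tuple u; t; z^-1]) (master_poly m n).

(* Main.v *)
Require Import Defs.
From mathcomp Require Import all_boot all_order all_algebra.
From mathcomp Require Import ring zify mpoly.

(** At a primitive r-th root of unity zeta, with r | n, almost all summands of
    the master polynomial vanish.  Written with Gaussian binomials, the summand
    of a chain n_1 <= ... <= n_m <= n_(m+1) = n is
      u^(mn - sum n_i) z^(-mn^2 + sum n_i^2)
        prod_i [n_(i+1), n_i]_z  prod_(n_1 <= j < n) (1 - u^-1 t z^(j+1)),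
    and this expression has no pole at zeta, unlike the quotients of Pochhammer
    symbols.  Since r divides n, [n, k]_zeta is 0 unless r divides k, and
    [ra, rb]_zeta is the ordinary binomial C(a, b): this is the comparison of
    coefficients in (X - 1)(X - zeta)...(X - zeta^(ra - 1)) = (X^r - 1)^a
    (lemma gauss_bin_prim_root).  So only chains of multiples of r survive;
    for these the power of zeta is 1, and the remaining product runs over full
    periods of the powers of zeta, hence is a power of 1 - (t/u)^r.  What is
    left is a multinomial expansion: with U = u^r and T = t^r,
      (1 + (U + ... + U^m)(1 - T/U))^(n/r),
    and summing the geometric progression gives the closed form.  The second
    equality is the first one at (u^r, t^r, 1) with n = r = 1.

    Summing over the last entry n_m of the chain first turns the multiple sum
    into a recursion on m (master_rec), in which the multinomial theorem becomes
    one binomial theorem per step (master_rec_prim_root).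

    The master polynomial is only known through its image in the fraction field
    of Z[u, t, z^-1], where z is an indeterminate, so its value at zeta has to
    be transported.  The relation specializes is the graph of the evaluation
    map on the local ring of fractions whose denominator does not vanish at the
    point; it is functional on polynomials and compatible with the field
    operations, hence it carries the recursion at the generic point to the
    recursion at zeta (master_evalE). *)

Set Implicit Arguments.
Unset Strict Implicit.
Unset Printing Implicit Defensive.

Import Order.TTheory GRing.Theory Num.Theory.
Local Open Scope ring_scope.

(** * Gaussian binomials *)

Section GaussBinomial.
Variable F : fieldType.
Implicit Types (z : F) (n k : nat).

Definition qpow z n : {poly F} := \prod_(j < n) ('X - (z ^+ j)%:P).

(** The Gaussian binomial [n, k]_z, read off the q-binomial theorem: the
    coefficient of X^k in (X - 1)(X - z)...(X - z^(n-1)) is [n, k]_z times the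
    constant coefficient of the product of the first n - k factors.  This
    quotient makes sense for every nonzero z, roots of unity included. *)
Definition gauss_bin z n k : F := (qpow z n)`_k / (qpow z (n - k))`_0.

Lemma qpow0 z : qpow z 0 = 1.
Proof. by rewrite /qpow big_ord0. Qed.

Lemma qpowS z n : qpow z n.+1 = qpow z n * ('X - (z ^+ n)%:P).
Proof. by rewrite /qpow big_ord_recr. Qed.

Lemma coef0_qpowS z n : (qpow z n.+1)`_0 = - (z ^+ n * (qpow z n)`_0).
Proof. by rewrite qpowS mulrBr coefB coefMX coefMC sub0r mulrC. Qed.

Lemma coefS_qpowS z n k :
  (qpow z n.+1)`_k.+1 = (qpow z n)`_k - z ^+ n * (qpow z n)`_k.+1.
Proof. by rewrite qpowS mulrBr coefB coefMX coefMC mulrC. Qed.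

Lemma coef0_qpow_neq0 z n : z != 0 -> (qpow z n)`_0 != 0.
Proof.
move=> z0; elim: n => [|n IH]; first by rewrite qpow0 coef1 oner_neq0.
by rewrite coef0_qpowS oppr_eq0 mulf_neq0 ?expf_neq0.
Qed.

Lemma size_qpow z n : size (qpow z n) = n.+1.
Proof. by rewrite /qpow size_prod_XsubC /index_enum -enumT size_enum_ord. Qed.

Lemma gauss_bin_gt z n k : (n < k)%N -> gauss_bin z n k = 0.
Proof. by move=> ltnk; rewrite /gauss_bin nth_default ?mul0r // size_qpow. Qed.

Lemma pochS A z n : poch A z n.+1 = poch A z n * (1 - A * z ^+ n).
Proof. by rewrite /poch big_ord_recr. Qed.

(** The q-binomial theorem, cleared of denominators so that it holds for all z.
    The induction is the q-Pascal rule: multiplying qpow by X - z^n mixes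
    the entries (a, b.+1) and (a.+1, b). *)
Lemma coef_qpow_poch z a b :
  (qpow z (a + b))`_a * (poch z z a * poch z z b) =
  poch z z (a + b) * (qpow z b)`_0.
Proof.
have P0 : poch z z 0 = 1 by rewrite /poch big_ord0.
have [n] := ubnP (a + b)%N; elim: n a b => // n IH [|a] b len.
  by rewrite add0n P0 mul1r mulrC.
rewrite addSn coefS_qpowS !pochS -!exprS.
have := IH a b len; case: b len => [|b] len.
  rewrite addn0 [X in _ - _ * X]nth_default ?size_qpow // => E.
  by rewrite mulr0 subr0 mulrAC mulrA E; ring.
have := IH a.+1 b; rewrite addSnnS => /(_ len).
rewrite !pochS -!exprS coef0_qpowS addnS !exprS exprD.
set x := z ^+ a; set y := z ^+ b; set A := poch z z a; set B := poch z z b.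
set D := poch z z _; set C := _`_a; set C' := _`_a.+1; set E := _`_0.
move=> IHr IHl.
transitivity (C * (A * (B * (1 - z * y))) * (1 - z * x)
  - z * (x * y) * (1 - z * y) * (C' * (A * (1 - z * x) * B))); first by ring.
rewrite IHl IHr; ring.
Qed.

Lemma gauss_binE z n k : z != 0 -> (forall j, 1 - z ^+ j.+1 != 0) -> (k <= n)%N ->
  gauss_bin z n k = poch z z n / (poch z z k * poch z z (n - k)).
Proof.
move=> z0 zn1 lekn.
have P0 i : poch z z i != 0.
  by apply/prodf_neq0 => j _; rewrite -exprS.
have := coef_qpow_poch z k (n - k); rewrite subnKC // => E.
apply/eqP; rewrite /gauss_bin eqr_div ?coef0_qpow_neq0 ?mulf_neq0 //.
exact/eqP.
Qed.

Lemma qpow_prim_root z r : r.-primitive_root z -> qpow z r = 'X^r - 1.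
Proof. by move=> zr; rewrite /qpow -(factor_Xn_sub_1 zr) big_mkord. Qed.

(** The powers of z repeat with period r, so the product consists of a copies
    of X^r - 1. *)
Lemma qpow_prim_root_mul z r a : r.-primitive_root z ->
  qpow z (r * a) = ('X - 1) ^+ a \Po 'X^r.
Proof.
move=> zr; elim: a => [|a IH].
  by rewrite muln0 qpow0 expr0 rmorph1.
rewrite exprSr rmorphM /= -IH [X in _ * X]rmorphB /= comp_polyX rmorph1.
rewrite -(qpow_prim_root zr) mulnS addnC /qpow big_split_ord /=.
congr (_ * _); apply: eq_bigr => j _.
by rewrite exprD exprM (prim_expr_order zr) expr1n mul1r.
Qed.

Lemma coef_Xsub1_exp (a b : nat) :
  (('X - 1 : {poly F}) ^+ a)`_b = (-1) ^+ (a - b) *+ 'C(a, b).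
Proof.
rewrite addrC exprDn coef_sum.
have [lt_ab|le_ba] := ltnP a b.
  rewrite bin_small // mulr0n big1 // => i _.
  rewrite -polyC1 -polyCN -polyC_exp coefMn coefCM coefXn.
  by case: eqP => [e|]; rewrite ?mulr0 ?mul0rn //; have := ltn_ord i; lia.
rewrite (bigD1 (Ordinal (le_ba : b < a.+1)%N)) //= big1 ?addr0.
  by rewrite -polyC1 -polyCN -polyC_exp coefMn coefCM coefXn eqxx mulr1.
move=> i neq_ib; rewrite -polyC1 -polyCN -polyC_exp coefMn coefCM coefXn.
by rewrite eq_sym (negPf (_ : i != b :> nat)) ?mulr0 ?mul0rn.
Qed.

(** The case of the q-Lucas theorem in which the upper entry is a multiple of r.
    The signs in numerator and denominator of gauss_bin agree and cancel. *)
Lemma gauss_bin_prim_root z r a k : (0 < r)%N -> r.-primitive_root z ->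
  gauss_bin z (r * a) k = if (r %| k)%N then 'C(a, k %/ r)%:R else 0.
Proof.
move=> r0 zr; rewrite /gauss_bin (qpow_prim_root_mul _ zr) coef_comp_poly_Xn //.
case: ifP => [/dvdnP[b ->]|]; last by rewrite mul0r.
rewrite mulnK // [(b * r)%N]mulnC -mulnBr (qpow_prim_root_mul _ zr).
rewrite coef_comp_poly_Xn //.
rewrite dvdn0 div0n !coef_Xsub1_exp subn0 bin0 mulr1n -[_ *+ 'C(_, _)]mulr_natl.
by rewrite mulfK // signr_eq0.
Qed.

End GaussBinomial.

(** * The master sum as a recursion on m *)

Section Recursion.
Variables (F : fieldType) (u t z : F).

(** The contribution of the last entry k = n_m of a chain ending at n.  The
    factor m in the exponents comes from telescoping: mn - sum n_i is
    m (n - n_m) plus the exponent (m-1) n_m - sum_(i < m) n_i of the chain that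
    is left, and likewise for the squares. *)
Definition master_weight m n k : F :=
  gauss_bin z n k * u ^+ (m * (n - k)) * z^-1 ^+ (m * (n ^ 2 - k ^ 2)) *
  \prod_(k <= j < n) (1 - u^-1 * t * z * z ^+ j).

Fixpoint master_rec m n : F :=
  if m is m'.+1 then \sum_(k < n.+1) master_weight m n k * master_rec m' k
  else 1.

(** The chain 0 = n_0, n_1, ..., n_m, n_(m+1) = n, for s = [:: n_1; ...; n_m];
    s is a plain list of numbers, so that cutting off n_m gives a chain again. *)
Definition chain (s : seq nat) n i := nth 0%N (0%N :: rcons s n) i.

Definition master_summand m n (s : seq nat) : F :=
  u ^ ((m * n)%:Z - \sum_(1 <= i < m.+1) (chain s n i)%:Z) *
  z ^ (- (m * n ^ 2)%:Z + \sum_(1 <= i < m.+1) ((chain s n i) ^ 2)%:Z) *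
  poch z z n * poch (u^-1 * t * z) z n *
  (\prod_(0 <= i < m.+1)
     inv_poch z ((chain s n i.+1)%:Z - (chain s n i)%:Z)) /
  poch (u^-1 * t * z) z (chain s n 1).

Hypothesis u0 : u != 0.
Hypothesis z0 : z != 0.
Hypothesis z_neq1 : forall j, 1 - z ^+ j.+1 != 0.
Hypothesis u_neq : forall j, 1 - u^-1 * t * z * z ^+ j != 0.

Lemma poch_quotient k n : (k <= n)%N ->
  \prod_(k <= j < n) (1 - u^-1 * t * z * z ^+ j) =
  poch (u^-1 * t * z) z n / poch (u^-1 * t * z) z k.
Proof.
move=> lekn; rewrite /poch -!(big_mkord predT (fun j => 1 - u^-1 * t * z * z ^+ j)).
rewrite [in RHS](big_cat_nat (leq0n k) lekn) /= [RHS]mulrAC divff ?mul1r //.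
by rewrite big_mkord; apply/prodf_neq0 => j _.
Qed.

Lemma chain_rcons s k n i : (i <= (size s).+1)%N ->
  chain (rcons s k) n i = chain s k i.
Proof. by case: i => // i lei; rewrite /chain /= nth_rcons size_rcons lei. Qed.

Lemma chain_last s n : chain s n (size s).+1 = n.
Proof. by rewrite /chain /= nth_rcons ltnn eqxx. Qed.

(** When k > n both sides are 0: on the left because 1 / (z; z)_(n - k) is 0 by
    convention, on the right because the Gaussian binomial vanishes.  So the
    truncated differences in master_weight are harmless. *)
Lemma master_summand_rcons s k n :
  master_summand (size s).+1 n (rcons s k) =
  master_weight (size s).+1 n k * master_summand (size s) k s.
Proof.
rewrite /master_summand; set m := size s.
have eqc i : (i <= m.+1)%N -> chain (rcons s k) n i = chain s k i.
  exact: chain_rcons.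
have el : chain (rcons s k) n m.+2 = n by rewrite -{1}(size_rcons s k) chain_last.
rewrite !(@big_nat_recr _ _ _ m.+1) //= el !eqc // chain_last.
have eqS (f : nat -> nat) : \sum_(1 <= i < m.+1) (f (chain (rcons s k) n i))%:Z =
    \sum_(1 <= i < m.+1) (f (chain s k i))%:Z.
  by apply: eq_big_nat => i /andP[_ lei]; rewrite eqc // ltnW.
rewrite (eqS id) (eqS (fun x => x ^ 2)%N).
under eq_big_nat => i /andP[_ lei] do rewrite !eqc // 1?ltnW //.
move: (\prod_(_ <= _ < _) _) => R.
move: (\sum_(_ <= _ < _) _ : int) (\sum_(_ <= _ < _) _ : int) => B A.
have [lt_nk|le_kn] := ltnP n k.
  rewrite /master_weight gauss_bin_gt // !mul0r.
  have : n%:Z - k%:Z < 0 by rewrite subr_lt0 ltz_nat.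
  by case: (_ - _) => //= j _; rewrite !mulr0 mul0r.
have P0 i : poch z z i != 0 by apply/prodf_neq0 => j _; rewrite -exprS.
have Q0 i : poch (u^-1 * t * z) z i != 0 by apply/prodf_neq0.
rewrite /master_weight poch_quotient // gauss_binE // subzn //=.
have -> : (m.+1 * n)%:Z - (A + k%:Z) = (m.+1 * (n - k))%N%:Z + ((m * k)%:Z - A).
  by rewrite mulnBr -subzn ?leq_mul2l ?le_kn ?orbT // mulSn; lia.
have -> : - (m.+1 * n ^ 2)%:Z + (B + (k ^ 2)%:Z) =
    - (m.+1 * (n ^ 2 - k ^ 2))%N%:Z + (- (m * k ^ 2)%:Z + B).
  have le2 : (k ^ 2 <= n ^ 2)%N by rewrite leq_sqr.
  rewrite mulnBr -subzn ?leq_mul2l ?le2 ?orbT //.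
  by rewrite [(m.+1 * k ^ 2)%N]mulSn; lia.
rewrite !expfzDr // -exprnP -exprnN -exprVn.
move: (_ ^ _) (_ ^ _) (_ ^+ _) (_ ^+ _) => x1 x2 x3 x4.
field.
by rewrite !P0 !Q0.
Qed.

Lemma sum_rcons_tuple (T : finType) m (f : seq T -> F) :
  \sum_(s : m.+1.-tuple T) f s = \sum_(k : T) \sum_(s : m.-tuple T) f (rcons s k).
Proof.
rewrite pair_bigA /=.
pose g (p : T * m.-tuple T) : m.+1.-tuple T := [tuple of rcons p.2 p.1].
rewrite (reindex g) //=; apply: onW_bij.
apply: inj_card_bij => [[k s] [k' s'] /(congr1 val)/eqP|].
  by rewrite /= eqseq_rcons => /andP[/eqP/val_inj-> /eqP->].
by rewrite card_prod !card_tuple expnS.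
Qed.

(** The bound N on the entries is kept apart from the end n of the chain, because
    the induction replaces n by the last entry but leaves the type of the tuples
    unchanged. *)
Lemma sum_master_summand N m n : (n <= N)%N ->
  \sum_(s : m.-tuple 'I_N.+1) master_summand m n [seq val k | k <- s] =
  master_rec m n.
Proof.
elim: m n => [|m IH] n leN.
  rewrite (eq_bigl (pred1 [tuple])); last first.
    by move=> s; rewrite (tuple0 s) /= eqxx.
  rewrite big_pred1_eq /master_summand big_nat1 !big_geq // /chain /=.
  rewrite !mul0n !subr0 !expr0z !mul1r /= addn0.
  have P0 i : poch z z i != 0 by apply/prodf_neq0 => j _; rewrite -exprS.
  have Q0 i : poch (u^-1 * t * z) z i != 0 by apply/prodf_neq0.
  by rewrite mulrAC mulfK // divff.
rewrite (sum_rcons_tuple m (fun s => master_summand m.+1 n (map val s))).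
transitivity (\sum_(k < N.+1) master_weight m.+1 n k * master_rec m k).
  apply: eq_bigr => k _; rewrite -(IH k (ltn_ord k)) mulr_sumr.
  apply: eq_bigr => s _; rewrite map_rcons.
  have := master_summand_rcons (map val s) (val k) n.
  by rewrite size_map size_tuple.
rewrite /= (@big_ord_widen _ _ _ n.+1 N.+1
  (fun k => master_weight m.+1 n k * master_rec m k)) //.
rewrite [LHS](bigID (fun k : 'I_N.+1 => (k < n.+1)%N)) /=.
rewrite [X in _ + X]big1 ?addr0 // => k; rewrite -leqNgt => ltnk.
by rewrite /master_weight gauss_bin_gt ?mul0r.
Qed.

Lemma master_sum_rec m n : master_sum u t z m n = master_rec m n.
Proof. exact: (sum_master_summand m (leqnn n)). Qed.

End Recursion.

(** * Evaluation at a root of unity *)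

Section RootOfUnity.
Variables (F : fieldType) (u t z : F) (r : nat).
Hypothesis r_gt0 : (0 < r)%N.
Hypothesis zr : r.-primitive_root z.
Hypothesis u0 : u != 0.

(** This is X^r - 1 = (X - 1)(X - z)...(X - z^(r-1)) at X = 1/x, times x^r,
    for nonzero x. *)
Lemma prod_prim_root x : \prod_(j < r) (1 - x * z ^+ j) = 1 - x ^+ r.
Proof.
have [->|x0] := eqVneq x 0.
  by rewrite expr0n gtn_eqF // big1 ?subr0 // => j _; rewrite mul0r subr0.
have := congr1 (fun p : {poly F} => x ^+ r * p.[x^-1]) (qpow_prim_root zr).
rewrite hornerD hornerN hornerXn hornerC mulrBr mulr1 exprVn divff ?expf_neq0 //.
move=> <-; rewrite /qpow horner_prod -[X in x ^+ X]card_ord -prodr_const -big_split.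
by apply: eq_bigr => j _; rewrite /= hornerXsubC mulrBr divff.
Qed.

Lemma prod_prim_root_periods x b a : (b <= a)%N ->
  \prod_(r * b <= j < r * a) (1 - x * z * z ^+ j) = (1 - x ^+ r) ^+ (a - b).
Proof.
move=> /subnK <-; rewrite addnK; elim: (a - b)%N => [|d IH].
  by rewrite add0n big_geq.
rewrite addSn mulnS addnC (@big_cat_nat _ _ _ (r * (d + b))) ?leq_addr //=.
  rewrite IH exprSr; congr (_ * _).
  rewrite -{1}[(r * (d + b))%N]add0n big_addn addKn big_mkord.
  (* replacing x by x * z only permutes the factors of a period *)
  have <- : (x * z) ^+ r = x ^+ r by rewrite exprMn (prim_expr_order zr) mulr1.
  rewrite -prod_prim_root; apply: eq_bigr => j _.
  by rewrite exprD [z ^+ (r * _)]exprM (prim_expr_order zr) expr1n mulr1.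
by rewrite leq_mul2l leq_addl orbT.
Qed.

Lemma sum_multiples (f : nat -> F) a :
  (forall k, ~~ (r %| k)%N -> f k = 0) ->
  \sum_(k < (r * a).+1) f k = \sum_(b < a.+1) f (r * b)%N.
Proof.
move=> f0; elim: a => [|a IH]; first by rewrite muln0 !big_ord1 muln0.
rewrite [RHS]big_ord_recr /= -IH -!(big_mkord predT f).
rewrite (@big_cat_nat _ _ _ (r * a).+1) ?ltnS ?leq_mul2l ?leqnSn ?orbT //=.
congr (_ + _); rewrite mulnS -(prednK r_gt0) addSn big_nat_recr /=; last first.
  by rewrite ltnS leq_addl.
rewrite big_nat_cond big1 ?add0r // => k /andP[/andP[lk uk] _].
apply: f0; apply/negP => /dvdnP[q Eq]; move: lk uk.
rewrite Eq (prednK r_gt0) [(q * r)%N]mulnC ltn_pmul2l // => lt_aq.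
have := leq_mul (leqnn r) lt_aq; rewrite mulnS; lia.
Qed.

Lemma master_weight_prim_root m a b : (b <= a)%N ->
  master_weight u t z m (r * a) (r * b) =
  ((u ^+ r) ^+ m * (1 - (u^-1 * t) ^+ r)) ^+ (a - b) *+ 'C(a, b).
Proof.
move=> leba; rewrite /master_weight (gauss_bin_prim_root _ _ r_gt0 zr).
rewrite dvdn_mulr // mulKn // prod_prim_root_periods //.
have -> : z^-1 ^+ (m * ((r * a) ^ 2 - (r * b) ^ 2)) = 1.
  rewrite exprVn; apply/eqP; rewrite invr_eq1 -(prim_order_dvd zr).
  by rewrite dvdn_mull // dvdn_sub // -mulnn -mulnA dvdn_mulr.
by rewrite -mulnBr mulnCA exprM [u ^+ _ ^+ _]exprM mulr1 -mulrA -exprMn mulr_natl.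
Qed.

(** Passing from m to m + 1 is the binomial theorem for the sum of the base for
    m and of U^(m+1) (1 - T/U), where U = u^r and T = t^r. *)
Lemma master_rec_prim_root m a :
  master_rec u t z m (r * a) =
  (1 + (\sum_(1 <= j < m.+1) (u ^+ r) ^+ j) * (1 - (u^-1 * t) ^+ r)) ^+ a.
Proof.
elim: m a => [|m IH] a; first by rewrite big_geq // mul0r addr0 expr1n.
rewrite [LHS]/=.
rewrite (@sum_multiples
  (fun k => master_weight u t z m.+1 (r * a) k * master_rec u t z m k)).
  rewrite big_nat_recr //= mulrDl addrA [X in X ^+ a]addrC exprDn.
  apply: eq_bigr => b _.
  by rewrite IH (master_weight_prim_root _ (ltn_ord b : b <= a)%N) mulrnAl.
move=> k Nrk; rewrite /master_weight (gauss_bin_prim_root _ _ r_gt0 zr).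
by rewrite (negPf Nrk) !mul0r.
Qed.

Lemma master_rec_prim_rootE m a : u ^+ r != 1 ->
  master_rec u t z m (r * a) =
  ((1 - t ^+ r + u ^+ (m * r) * t ^+ r - u ^+ (m.+1 * r)) / (1 - u ^+ r)) ^+ a.
Proof.
move=> ur1; rewrite master_rec_prim_root; congr (_ ^+ _).
rewrite exprMn exprVn [(m * r)%N]mulnC [(m.+1 * r)%N]mulnC !exprM.
have ur0 : u ^+ r != 0 by rewrite expf_neq0.
move: (u ^+ r) (t ^+ r) ur0 ur1 => U T U0 U1.
have nU : 1 - U != 0 by rewrite subr_eq0 eq_sym.
apply: (mulIf nU); rewrite divfK //.
elim: m => [|m IHm]; first by rewrite big_geq // expr0 expr1; ring.
rewrite big_nat_recr //= [(_ + U ^+ _) * _]mulrDl addrA [LHS]mulrDl IHm !exprS.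
by field.
Qed.

End RootOfUnity.

(** * Specialization of fractions *)

Section Specialization.
Variables (A : idomainType) (K : fieldType) (phi : {rmorphism A -> K}).
Implicit Types (x : {fraction A}) (y : K).

(** The graph of the extension of phi to the localization of A at the kernel of
    phi.  A relation avoids building that local ring as a type. *)
Definition specializes x y : Prop := exists p q : A,
  [/\ phi q != 0, x * tofrac q = tofrac p & y * phi q = phi p].

Lemma tofrac_neq0 (q : A) : phi q != 0 -> tofrac q != 0.
Proof. by rewrite tofrac_eq0; apply: contraNneq => ->; rewrite rmorph0. Qed.

Lemma specializes_tofrac p : specializes (tofrac p) (phi p).
Proof. by exists p, 1; rewrite !rmorph1 !mulr1 oner_neq0. Qed.

Lemma specializes_tofrac_eq p y : specializes (tofrac p) y -> y = phi p.
Proof.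
move=> [p' [q [q0 e1 e2]]]; apply: (mulIf q0); rewrite e2 -rmorphM.
by congr (phi _); apply/eqP; rewrite -tofrac_eq -e1 rmorphM.
Qed.

Lemma specializesN x y : specializes x y -> specializes (- x) (- y).
Proof.
by move=> [p [q [q0 e1 e2]]]; exists (- p), q; rewrite !mulNr e1 e2 !rmorphN.
Qed.

Lemma specializesD x x' y y' :
  specializes x y -> specializes x' y' -> specializes (x + x') (y + y').
Proof.
move=> [p [q [q0 e1 e2]]] [p' [q' [q0' e1' e2']]].
exists (p * q' + p' * q), (q * q'); rewrite !rmorphD !rmorphM mulf_neq0 //=.
by split; rewrite // -?e1 -?e1' -?e2 -?e2'; ring.
Qed.

Lemma specializesM x x' y y' :
  specializes x y -> specializes x' y' -> specializes (x * x') (y * y').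
Proof.
move=> [p [q [q0 e1 e2]]] [p' [q' [q0' e1' e2']]].
exists (p * p'), (q * q'); rewrite !rmorphM mulf_neq0 //.
by split; rewrite // mulrACA ?e1 ?e1' ?e2 ?e2'.
Qed.

Lemma specializesV x y : y != 0 -> specializes x y -> specializes x^-1 y^-1.
Proof.
move=> y0 [p [q [q0 e1 e2]]].
have p0 : phi p != 0 by rewrite -e2 mulf_neq0.
have x0 : x != 0.
  by apply: contraTneq (tofrac_neq0 p0) => x0; rewrite -e1 x0 mul0r eqxx.
by exists q, p; rewrite -e1 -e2 !mulKf // mulf_neq0.
Qed.

Lemma specializes1 : specializes 1 1.
Proof. by have := specializes_tofrac 1; rewrite !rmorph1. Qed.

Lemma specializes0 : specializes 0 0.
Proof. by have := specializes_tofrac 0; rewrite !rmorph0. Qed.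

Lemma specializesX x y n : specializes x y -> specializes (x ^+ n) (y ^+ n).
Proof.
move=> sxy; elim: n => [|n IH]; first by rewrite !expr0; exact: specializes1.
by rewrite !exprS; apply: specializesM.
Qed.

Lemma specializes_sum I (s : seq I) f g : (forall i, specializes (f i) (g i)) ->
  specializes (\sum_(i <- s) f i) (\sum_(i <- s) g i).
Proof.
move=> h; elim/big_ind2: _ => //; first exact: specializes0.
by move=> *; apply: specializesD.
Qed.

Lemma specializes_prod I (s : seq I) f g : (forall i, specializes (f i) (g i)) ->
  specializes (\prod_(i <- s) f i) (\prod_(i <- s) g i).
Proof.
move=> h; elim/big_ind2: _ => //; first exact: specializes1.
by move=> *; apply: specializesM.
Qed.

Lemma specializes_coef_qpow x y n k : specializes x y ->
  specializes (qpow x n)`_k (qpow y n)`_k.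
Proof.
move=> sxy; elim: n k => [|n IH] k.
  rewrite !qpow0 !coef1.
  by case: eqP => _; [exact: specializes1|exact: specializes0].
case: k => [|k].
  rewrite !coef0_qpowS.
  by apply/specializesN/specializesM => //; apply: specializesX.
rewrite !coefS_qpowS; apply: specializesD => //.
by apply/specializesN/specializesM => //; apply: specializesX.
Qed.

Lemma specializes_master_rec (u t z : {fraction A}) (u' t' z' : K) m n :
  u' != 0 -> z' != 0 ->
  specializes u u' -> specializes t t' -> specializes z z' ->
  specializes (master_rec u t z m n) (master_rec u' t' z' m n).
Proof.
move=> u0 z0 su st sz.
elim: m n => [|m IH] n /=; first exact: specializes1.
apply: specializes_sum => k; apply: specializesM => //.
apply: specializesM; first apply: specializesM.
- apply: specializesM; last exact: specializesX.
  apply: specializesM; first exact: specializes_coef_qpow.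
  by apply: specializesV; [exact: coef0_qpow_neq0|exact: specializes_coef_qpow].
- by apply/specializesX/specializesV.
apply: specializes_prod => j; apply: specializesD; first exact: specializes1.
apply/specializesN/specializesM; last exact: specializesX.
by do 2!apply: specializesM => //; apply: specializesV.
Qed.

End Specialization.

(** * The master polynomial at a point *)

Section GenericPoint.
Local Notation X i := (tofrac ('X_i : {mpoly int[3]})).

Lemma mpolyX_neq0 (i : 'I_3) : X i != 0.
Proof.
rewrite tofrac_eq0; apply/eqP => /(congr1 (meval (fun=> 1 : int))).
by rewrite mevalXU meval0.
Qed.

(** At the generic point no 1 - z^j and no 1 - u^-1 t z^j vanishes: clear the
    denominators and evaluate at the origin, respectively at u = z^-1 = 0 and
    t = 1. *)
Lemma master_fracE m n : master_frac m n = master_rec (X 0) (X 1) (X 2)^-1 m n.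
Proof.
have X0 := mpolyX_neq0.
apply: master_sum_rec; rewrite ?invr_eq0 ?X0 // => j; apply/eqP => /eqP.
  rewrite subr_eq0 exprVn eq_sym invr_eq1 -tofracXn -tofrac1 tofrac_eq => /eqP.
  move/(congr1 (meval (fun=> 0 : int))).
  by rewrite meval1 rmorphXn /= mevalXU expr0n.
rewrite -mulrA -exprS subr_eq0 exprVn eq_sym => /eqP E.
have : X 1 = X 0 * X 2 ^+ j.+1.
  have d0 : X 2 ^+ j.+1 != 0 by rewrite expf_neq0.
  rewrite -[X 1](mulVKf (X0 0)); congr (_ * _).
  by apply: (mulIf (invr_neq0 d0)); rewrite E divff.
rewrite -tofracXn -tofracM => /eqP; rewrite tofrac_eq => /eqP.
move/(congr1 (meval (fun i => (i == 1)%:R : int))).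
by rewrite mevalM !mevalXU mul0r.
Qed.

(** The recursion, unlike the defining sum, has no pole at roots of unity: the
    Gaussian binomials only have powers of z in their denominators. *)
Lemma master_evalE (K : fieldType) (u t z : K) m n : u != 0 -> z != 0 ->
  master_eval m n u t z = master_rec u t z m n.
Proof.
move=> u0 z0; rewrite /master_eval.
set h := tnth _.
pose phi : {rmorphism {mpoly int[3]} -> K} := mmap intr h.
suff: specializes phi (tofrac (master_poly m n)) (master_rec u t z m n).
  by move/specializes_tofrac_eq ->.
have sX i : specializes phi (X i) (h i).
  by have := specializes_tofrac phi 'X_i; rewrite /phi /= mmapX mmap1U.
rewrite master_polyE master_fracE; apply: specializes_master_rec => //.
by rewrite -(invrK z); apply: specializesV; [rewrite invr_eq0|exact: (sX 2)].
Qed.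

End GenericPoint.

Lemma master_eval_prim_root (K : fieldType) (u t z : K) m n r :
  (0 < r)%N -> (r %| n)%N -> r.-primitive_root z -> u != 0 -> u ^+ r != 1 ->
  master_eval m n u t z =
    ((1 - t ^+ r + u ^+ (m * r) * t ^+ r - u ^+ (m.+1 * r)) / (1 - u ^+ r))
      ^+ (n %/ r).
Proof.
move=> r0 rn zr u0 u1; rewrite master_evalE //.
  by rewrite -{1}(divnK rn) mulnC (master_rec_prim_rootE _ r0 zr).
apply: contraTneq (oner_neq0 K) => z0.
by rewrite -(prim_expr_order zr) z0 expr0n gtn_eqF // eqxx.
Qed.

Lemma prim_root1 (K : fieldType) : 1.-primitive_root (1 : K).
Proof.
apply/andP; split=> //; apply/forallP => i.
by rewrite ord1 unity_rootE expr1n !eqxx.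
Qed.

Lemma master_eval_prim_root_exp (K : fieldType) (u t z : K) m n r :
  (0 < r)%N -> (r %| n)%N -> r.-primitive_root z -> u != 0 -> u ^+ r != 1 ->
  master_eval m n u t z = master_eval m 1 (u ^+ r) (t ^+ r) 1 ^+ (n %/ r).
Proof.
move=> r0 rn zr u0 u1; rewrite (master_eval_prim_root t m r0 rn zr) //.
rewrite (master_eval_prim_root _ _ _ _ (prim_root1 K)) ?expf_neq0 //.
by rewrite divn1 !expr1 !muln1 -!exprM [(r * m)%N]mulnC [(r * m.+1)%N]mulnC.
Qed.

Theorem theorem6p8 (C : numClosedFieldType) (m n r : nat) (zeta : C)
    (hm : (1 <= m)%N) (hn : (1 <= n)%N) (hr : (1 <= r)%N) (hrn : (r %| n)%N)
    (hzeta : r.-primitive_root zeta) :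
  let K := {fraction {mpoly C[2]}} in
  let u : K := tofrac 'X_0 in
  let t : K := tofrac 'X_1 in
  let z : K := tofrac zeta%:MP in
  master_eval m n u t z =
    ((1 - t ^+ r + u ^+ (m * r) * t ^+ r - u ^+ (m.+1 * r)) / (1 - u ^+ r))
      ^+ (n %/ r)
  /\ master_eval m n u t z =
    master_eval m 1 (u ^+ r) (t ^+ r) 1 ^+ (n %/ r).
Proof.
move=> K u t z.
have zr : r.-primitive_root z.
  rewrite -(fmorph_primitive_root (@tofrac _ \o @mpolyC 2 C)) in hzeta.
  exact: hzeta.
have u0 : u != 0.
  rewrite tofrac_eq0; apply/eqP => /(congr1 (meval (fun=> 1 : C))) /eqP.
  by rewrite mevalXU meval0 oner_eq0.
have u1 : u ^+ r != 1.
  rewrite -tofracXn -tofrac1 tofrac_eq; apply/eqP.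
  move=> /(congr1 (meval (fun=> 0 : C))) /eqP.
  by rewrite meval1 rmorphXn /= mevalXU expr0n gtn_eqF // eq_sym oner_eq0.
split.
  exact (@master_eval_prim_root _ u t z m n r hr hrn zr u0 u1).
exact (@master_eval_prim_root_exp _ u t z m n r hr hrn zr u0 u1).
Qed.
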